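(* The Sierpinski gasket $(\mathbb{S},\sigma)$ is not the final co-algebra of $F_3$ on $\mathbf{MS}_3^{L}$.
   Context: A tri-pointed metric space is a set $X$ with three distinguished elements $T,L,R$ and a metric $d\le 1$ such that distinct distinguished elements are at distance $1$. $\mathbf{MS}_3^{L}$ is the category of tri-pointed metric spaces with Lipschitz maps preserving the distinguished elements. Let $M_3=\{a,b,c\}$. $M_3\otimes X$ is the quotient of $M_3\times X$ by the equivalence relation generated by $(b,T)\sim(a,L)$, $(a,R)\sim(c,T)$, $(c,L)\sim(b,R)$, with distinguished elements $T=a\otimes T$, $L=b\otimes L$, $R=c\otimes R$; $m\otimes x$ is the class of $(m,x)$. It carries the metric $d(m\otimes x,m\otimes y)=\frac12 d(x,y)$, $d(a\otimes x,b\otimes y)=\frac12\min\{d(x,L)+d(T,y),\,d(x,R)+1+d(R,y)\}$, $d(a\otimes x,c\otimes y)=\frac12\min\{d(x,R)+d(T,y),\,d(x,L)+1+d(L,y)\}$, $d(b\otimes x,c\otimes y)=\frac12\min\{d(x,R)+d(L,y),\,d(x,T)+1+d(T,y)\}$. The endofunctor $F_3$ is $F_3X=M_3\otimes X$, $(F_3f)(m\otimes x)=(M_3\otimes f)(m\otimes x)=m\otimes f(x)$. An $F_3$ co-algebra is an object $X$ with a morphism $e:X\to M_3\otimes X$; a morphism $(X,e)\to(Y,e')$ is a morphism $f:X\to Y$ with $e'\circ f=(M_3\otimes f)\circ e$; a final co-algebra is a terminal object in the category of co-algebras. The Sierpinski gasket $\mathbb{S}\subset\mathbb{R}^2$ is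 the unique nonempty compact set with $\mathbb{S}=\sigma_a(\mathbb{S})\cup\sigma_b(\mathbb{S})\cup\sigma_c(\mathbb{S})$, where $\sigma_a(p)=\frac12(p+T)$, $\sigma_b(p)=\frac12(p+L)$, $\sigma_c(p)=\frac12(p+R)$ and $T=(\frac12,\frac{\sqrt3}{2})$, $L=(0,0)$, $R=(1,0)$. It has the Euclidean metric and distinguished elements $T,L,R$. The map $M_3\otimes\mathbb{S}\to\mathbb{S}$, $m\otimes p\mapsto\sigma_m(p)$, is a bijection, and $\sigma:\mathbb{S}\to M_3\otimes\mathbb{S}$ denotes its inverse. *)

(* Defs.v *)
From HB Require Import structures.
From Stdlib Require Import Relation_Operators.
From mathcomp Require Import all_boot all_order all_algebra.
From mathcomp Require Import ring lra.
From mathcomp Require Import all_classical all_reals all_analysis.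

Set Implicit Arguments.
Unset Strict Implicit.
Unset Printing Implicit Defensive.

Import Order.TTheory GRing.Theory Num.Theory.
Import numFieldNormedType.Exports.

Local Open Scope classical_set_scope.
Local Open Scope ring_scope.
Local Open Scope quotient_scope.

Inductive M3 := Ma | Mb | Mc.

Definition M3_to_nat (m : M3) : nat :=
  match m with Ma => 0 | Mb => 1 | Mc => 2 end.
Definition nat_to_M3 (i : nat) : M3 :=
  match i with 0%N => Ma | 1%N => Mb | _ => Mc end.
Lemma M3_to_natK : cancel M3_to_nat nat_to_M3.
Proof. by case. Qed.
HB.instance Definition _ := Equality.copy M3 (can_type M3_to_natK).
HB.instance Definition _ := Choice.copy M3 (can_type M3_to_natK).

Record triMetric (R : realType) := TriMetric {
  tm_sort :> metricType R;
  ptT : tm_sort;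
  ptL : tm_sort;
  ptR : tm_sort;
  tm_le1 : forall x y : tm_sort, mdist x y <= 1;
  tm_TL : mdist ptT ptL = 1;
  tm_TR : mdist ptT ptR = 1;
  tm_LR : mdist ptL ptR = 1 }.
Arguments ptT {R t}.
Arguments ptL {R t}.
Arguments ptR {R t}.

Record triHom (R : realType) (X Y : triMetric R) := TriHom {
  tri_fun :> X -> Y;
  tri_lipschitz : exists K : R, forall x y,
    mdist (tri_fun x) (tri_fun y) <= K * mdist x y;
  tri_T : tri_fun ptT = ptT;
  tri_L : tri_fun ptL = ptL;
  tri_R : tri_fun ptR = ptR }.

Section Tensor.
Variables (R : realType) (X : triMetric R).

Inductive glue : M3 * X -> M3 * X -> Prop :=
| glue_bT_aL : glue (Mb, ptT) (Ma, ptL)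
| glue_aR_cT : glue (Ma, ptR) (Mc, ptT)
| glue_cL_bR : glue (Mc, ptL) (Mb, ptR).

Definition tensor_eq (p q : M3 * X) : bool :=
  `[< clos_refl_sym_trans _ glue p q >].

Lemma tensor_eq_refl : reflexive tensor_eq.
Proof. by move=> p; apply/asboolP; apply: rst_refl. Qed.
Lemma tensor_eq_sym : symmetric tensor_eq.
Proof.
by move=> p q; apply/idP/idP => /asboolP h; apply/asboolP; apply: rst_sym.
Qed.
Lemma tensor_eq_trans : transitive tensor_eq.
Proof.
by move=> q p r /asboolP h1 /asboolP h2; apply/asboolP; apply: rst_trans h1 h2.
Qed.
Canonical tensor_equiv :=
  EquivRel tensor_eq tensor_eq_refl tensor_eq_sym tensor_eq_trans.

Definition tensor : Type := {eq_quot tensor_equiv}.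
HB.instance Definition _ := Choice.on tensor.
HB.instance Definition _ := EqQuotient.on tensor.

Definition tens (m : M3) (x : X) : tensor := \pi_tensor (m, x).

Definition dist_ab (x y : X) : R :=
  2^-1 * Num.min (mdist x ptL + mdist ptT y) (mdist x ptR + 1 + mdist ptR y).
Definition dist_ac (x y : X) : R :=
  2^-1 * Num.min (mdist x ptR + mdist ptT y) (mdist x ptL + 1 + mdist ptL y).
Definition dist_bc (x y : X) : R :=
  2^-1 * Num.min (mdist x ptR + mdist ptL y) (mdist x ptT + 1 + mdist ptT y).

Definition pre_dist (p q : M3 * X) : R :=
  let: (m, x) := p in let: (n, y) := q in
  match m, n with
  | Ma, Ma | Mb, Mb | Mc, Mc => 2^-1 * mdist x y
  | Ma, Mb => dist_ab x y
  | Mb, Ma => dist_ab y x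
  | Ma, Mc => dist_ac x y
  | Mc, Ma => dist_ac y x
  | Mb, Mc => dist_bc x y
  | Mc, Mb => dist_bc y x
  end.

(* The value does not depend on the representatives: see [tens_dist]. *)
Definition tensor_dist (u v : tensor) : R := pre_dist (repr u) (repr v).

Definition corner (m : M3) : X :=
  match m with Ma => ptT | Mb => ptL | Mc => ptR end.
Definition third (m n : M3) : M3 :=
  match m, n with
  | Ma, Mb | Mb, Ma => Mc
  | Ma, Mc | Mc, Ma => Mb
  | _, _ => Ma
  end.

Lemma corner_dist m n : m != n -> mdist (corner m) (corner n) = 1.
Proof.
case: m n => [] [] // _ /=; rewrite ?tm_TL ?tm_TR ?tm_LR // metric_sym.
all: by rewrite ?tm_TL ?tm_TR ?tm_LR.
Qed.

Lemma pre_dist_ne m n (x y : X) : m != n ->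
  pre_dist (m, x) (n, y) = 2^-1 *
    Num.min (mdist x (corner n) + mdist (corner m) y)
            (mdist x (corner (third m n)) + 1 + mdist (corner (third m n)) y).
Proof.
case: m n => [] [] // _ /=; rewrite /dist_ab /dist_ac /dist_bc //.
all: congr (_ * Num.min _ _).
all: rewrite !(metric_sym y) !(metric_sym x); ring.
Qed.

Lemma pre_dist_eq m (x y : X) : pre_dist (m, x) (m, y) = 2^-1 * mdist x y.
Proof. by case: m. Qed.

Lemma pre_dist_sym p q : pre_dist p q = pre_dist q p.
Proof. by move: p q => [[] x] [[] y] //=; rewrite metric_sym. Qed.

Lemma pre_dist_refl p : pre_dist p p = 0.
Proof. by case: p => m x; rewrite pre_dist_eq mdistxx mulr0. Qed.

Lemma third_ne m n : m != n -> (third m n != m) && (third m n != n).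
Proof. by case: m n => [] []. Qed.

Lemma third_sym m n : third m n = third n m.
Proof. by case: m n => [] []. Qed.

Lemma third_third m n k : m != n -> n != k -> m != k ->
  [/\ third m n = k, third n k = m & third m k = n].
Proof. by case: m n k => [] [] []. Qed.

Lemma pre_dist_triangle q p r : pre_dist p r <= pre_dist p q + pre_dist q r.
Proof.
move: p q r => [m x] [n y] [k z].
have tri (a b c : X) := metric_triangle a b c.
have ge0 (a b : X) := mdist_ge0 a b.
have le1 (a b : X) := tm_le1 a b.
have [mn|mn] := eqVneq m n; have [nk|nk] := eqVneq n k.
- by subst; rewrite !pre_dist_eq; have := tri x y z; lra.
- subst; rewrite pre_dist_eq !pre_dist_ne //.
  set w := corner (third _ _).
  have := tri x y (corner k); have := tri x y w.
  rewrite /Num.min; do 2 case: ifP; rewrite -?leNgt //; lra.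
- subst; rewrite pre_dist_eq !pre_dist_ne //.
  set w := corner (third _ _).
  have := tri (corner m) y z; have := tri w y z.
  rewrite /Num.min; do 2 case: ifP; rewrite -?leNgt //; lra.
- have [mk|mk] := eqVneq m k.
    subst k; rewrite pre_dist_eq !pre_dist_ne // (third_sym n m).
    set w := corner (third _ _).
    have := tri x (corner n) z; have := ge0 (corner m) y.
    have := ge0 y (corner m); have := le1 x z.
    have := ge0 x w; have := ge0 w y; have := ge0 y w; have := ge0 w z.
    have := ge0 x (corner n); have := ge0 (corner n) z.
    rewrite /Num.min; do 2 case: ifP; rewrite -?leNgt //; lra.
  have [e1 e2 e3] := third_third mn nk mk.
  rewrite !pre_dist_ne // e1 e2 e3.
  have := corner_dist mk; have := corner_dist mn; have := corner_dist nk.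
  set A := corner m; set B := corner n; set C := corner k => BC AB AC.
  have := tri A y C; have := le1 A z; have := le1 x C.
  have := ge0 x A; have := ge0 x B; have := ge0 x C.
  have := ge0 y A; have := ge0 y B; have := ge0 y C.
  have := ge0 z A; have := ge0 z B; have := ge0 z C.
  have := metric_sym y A; have := metric_sym y B; have := metric_sym y C.
  have := metric_sym z A; have := metric_sym z B; have := metric_sym z C.
  rewrite /Num.min; do 3 case: ifP; rewrite -?leNgt //; lra.
Qed.

Lemma pre_dist_ge0 p q : 0 <= pre_dist p q.
Proof.
have := pre_dist_triangle q p p; rewrite pre_dist_refl (pre_dist_sym q p); lra.
Qed.

Lemma pre_dist_le1 p q : pre_dist p q <= 1.
Proof.
move: p q => [m x] [n y]; have [<-|mn] := eqVneq m n.
  by rewrite pre_dist_eq; have := tm_le1 x y; lra.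
rewrite pre_dist_ne //.
have := tm_le1 x (corner n); have := tm_le1 (corner m) y.
rewrite /Num.min; case: ifP; rewrite -?leNgt //; lra.
Qed.

Lemma pre_dist_corner m n : m != n ->
  pre_dist (m, corner m) (n, corner n) = 1.
Proof.
move=> mn; rewrite pre_dist_ne // corner_dist //.
have /andP[km kn] := third_ne mn.
rewrite (corner_dist kn) (corner_dist (m := m)) 1?eq_sym //.
by rewrite min_l; lra.
Qed.

Lemma glue_corner m n : m != n -> tensor_eq (m, corner n) (n, corner m).
Proof.
case: m n => [] [] // _; apply/asboolP.
all: by [apply: rst_step; constructor | apply: rst_sym; apply: rst_step; constructor].
Qed.

Lemma pre_dist0 p q : tensor_eq p q = (pre_dist p q == 0).
Proof.
apply/idP/eqP => [/asboolP h|].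
  elim: h => {p q} [p q [] /=||p q _|p q r _ h1 _ h2].
  - rewrite /dist_ab !mdistxx min_l ?addr0 ?mulr0 //.
    have := mdist_ge0 (@ptL _ X) ptR; have := mdist_ge0 (@ptR _ X) ptT; lra.
  - rewrite /dist_ac !mdistxx min_l ?addr0 ?mulr0 //.
    have := mdist_ge0 (@ptR _ X) ptL; have := mdist_ge0 (@ptL _ X) ptT; lra.
  - rewrite /dist_bc !mdistxx min_l ?addr0 ?mulr0 //.
    have := mdist_ge0 (@ptT _ X) ptL; have := mdist_ge0 (@ptR _ X) ptT; lra.
  - exact: pre_dist_refl.
  - by rewrite pre_dist_sym.
  - apply/eqP; rewrite eq_le pre_dist_ge0 andbT.
    by rewrite (le_trans (pre_dist_triangle q _ _)) // h1 h2 addr0.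
move: p q => [m x] [n y]; have [<-|mn] := eqVneq m n.
  rewrite pre_dist_eq => h; have /mdist_positivity -> : mdist x y = 0 by lra.
  exact: tensor_eq_refl.
rewrite pre_dist_ne // => h.
have h1 := mdist_ge0 x (corner n); have h2 := mdist_ge0 (corner m) y.
have h3 := mdist_ge0 x (corner (third m n)).
have h4 := mdist_ge0 (corner (third m n)) y.
have e : mdist x (corner n) + mdist (corner m) y = 0.
  by move: h; rewrite /Num.min; case: ifP; rewrite -?leNgt //; lra.
have /mdist_positivity -> : mdist x (corner n) = 0 by lra.
have /mdist_positivity <- : mdist (corner m) y = 0 by lra.
exact: glue_corner.
Qed.

Lemma tens_ind (P : tensor -> Prop) : (forall m x, P (tens m x)) -> forall u, P u.
Proof. by move=> h u; rewrite -(reprK u); case: (repr u) => m x; apply: h. Qed.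

Lemma tensP m n (x y : X) :
  (tens m x = tens n y) <-> pre_dist (m, x) (n, y) = 0.
Proof.
have eqE : (tens m x == tens n y) = tensor_eq (m, x) (n, y).
  by rewrite /tens -(pi_eq_quot (s := tensor)).
split=> [/eqP|] h; [apply/eqP | apply/eqP]; first by rewrite -pre_dist0 -eqE.
by rewrite eqE pre_dist0 h.
Qed.

Lemma repr_dist (p : M3 * X) : pre_dist (repr (\pi_tensor p)) p = 0.
Proof.
case E : (repr _) => [m x]; case: p E => n y E; apply/tensP.
by rewrite /tens -E reprK.
Qed.

Lemma tens_dist m n (x y : X) :
  tensor_dist (tens m x) (tens n y) = pre_dist (m, x) (n, y).
Proof.
rewrite /tensor_dist /tens; set p := (m, x); set q := (n, y).
have hp := repr_dist p; have hq := repr_dist q.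
set p' := repr _ in hp *; set q' := repr _ in hq *.
apply/eqP; rewrite eq_le; apply/andP; split.
  have := pre_dist_triangle p p' q'; have := pre_dist_triangle q p q'.
  by rewrite (pre_dist_sym q q'); lra.
have := pre_dist_triangle p' p q; have := pre_dist_triangle q' p' q.
by rewrite (pre_dist_sym p p'); lra.
Qed.

Lemma tensor_distxx u : tensor_dist u u = 0.
Proof. exact: pre_dist_refl. Qed.
Lemma tensor_dist0 u v : tensor_dist u v = 0 -> u = v.
Proof.
elim/tens_ind: u => m x; elim/tens_ind: v => n y.
by rewrite tens_dist => /tensP.
Qed.
Lemma tensor_dist_sym u v : tensor_dist u v = tensor_dist v u.
Proof. exact: pre_dist_sym. Qed.
Lemma tensor_dist_triangle v u w :
  tensor_dist u w <= tensor_dist u v + tensor_dist v w.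
Proof. exact: pre_dist_triangle. Qed.

HB.instance Definition _ := isMetric.Build R tensor
  tensor_distxx tensor_dist0 tensor_dist_sym tensor_dist_triangle.

Lemma tensor_le1 (u v : tensor) : mdist u v <= 1.
Proof. exact: pre_dist_le1. Qed.
Lemma tensor_TL : mdist (tens Ma ptT) (tens Mb ptL) = 1.
Proof. by rewrite [LHS]tens_dist (@pre_dist_corner Ma Mb). Qed.
Lemma tensor_TR : mdist (tens Ma ptT) (tens Mc ptR) = 1.
Proof. by rewrite [LHS]tens_dist (@pre_dist_corner Ma Mc). Qed.
Lemma tensor_LR : mdist (tens Mb ptL) (tens Mc ptR) = 1.
Proof. by rewrite [LHS]tens_dist (@pre_dist_corner Mb Mc). Qed.

Definition F3 : triMetric R :=
  TriMetric tensor_le1 tensor_TL tensor_TR tensor_LR.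

End Tensor.

Section F3Map.
Variables (R : realType) (X Y : triMetric R) (f : triHom X Y).

Definition tensor_map (u : tensor X) : tensor Y :=
  tens (repr u).1 (f (repr u).2).

Lemma tri_corner m : f (corner X m) = corner Y m.
Proof. by case: m => /=; rewrite ?tri_T ?tri_L ?tri_R. Qed.

Lemma tri_lipschitz1 : exists2 K : R, 1 <= K &
  forall x y, mdist (f x) (f y) <= K * mdist x y.
Proof.
have [K h] := tri_lipschitz f; exists (Num.max 1 K); first by rewrite le_max lexx.
move=> x y; apply: le_trans (h x y) _.
by rewrite ler_wpM2r ?mdist_ge0 // le_max lexx orbT.
Qed.

Lemma pre_dist_map (K : R) : 1 <= K ->
  (forall x y, mdist (f x) (f y) <= K * mdist x y) ->
  forall m n x y, pre_dist (m, f x) (n, f y) <= K * pre_dist (m, x) (n, y).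
Proof.
move=> K1 h m n x y; have [<-|mn] := eqVneq m n.
  by rewrite !pre_dist_eq; have := h x y; lra.
rewrite !pre_dist_ne // -!tri_corner.
have := h x (corner X n); have := h (corner X m) y.
have := h x (corner X (third m n)); have := h (corner X (third m n)) y.
rewrite /Num.min; do 2 case: ifP; rewrite -?leNgt //; nra.
Qed.

Lemma tensor_map_tens m x : tensor_map (tens m x) = tens m (f x).
Proof.
rewrite /tensor_map; have := repr_dist (m, x).
rewrite -/(tens m x); case: (repr _) => n y h; apply/tensP.
have [K K1 hK] := tri_lipschitz1.
have := pre_dist_map K1 hK n m y x; rewrite [pre_dist (n, y) _]h mulr0.
by have := pre_dist_ge0 (n, f y) (m, f x); lra.
Qed.

Lemma tensor_map_lipschitz : exists K : R, forall u v : F3 X,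
  mdist (tensor_map u : F3 Y) (tensor_map v) <= K * mdist u v.
Proof.
have [K K1 hK] := tri_lipschitz1; exists K.
elim/tens_ind => m x; elim/tens_ind => n y; rewrite !tensor_map_tens.
rewrite [X in X <= _]tens_dist [X in _ * X]tens_dist.
exact: pre_dist_map.
Qed.

Lemma tensor_map_T : tensor_map (@ptT _ (F3 X)) = (@ptT _ (F3 Y)).
Proof. by rewrite [LHS]tensor_map_tens tri_T. Qed.
Lemma tensor_map_L : tensor_map (@ptL _ (F3 X)) = (@ptL _ (F3 Y)).
Proof. by rewrite [LHS]tensor_map_tens tri_L. Qed.
Lemma tensor_map_R : tensor_map (@ptR _ (F3 X)) = (@ptR _ (F3 Y)).
Proof. by rewrite [LHS]tensor_map_tens tri_R. Qed.

Definition F3_map : triHom (F3 X) (F3 Y) :=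
  @TriHom _ (F3 X) (F3 Y) tensor_map tensor_map_lipschitz
    tensor_map_T tensor_map_L tensor_map_R.

End F3Map.

Record F3_coalgebra (R : realType) := F3Coalgebra {
  co_carrier :> triMetric R;
  co_map : triHom co_carrier (F3 co_carrier) }.

Definition coalgebra_morphism (R : realType) (C D : F3_coalgebra R)
    (f : triHom C D) : Prop :=
  forall x : C, co_map D (f x) = F3_map f (co_map C x).

Definition final_coalgebra (R : realType) (D : F3_coalgebra R) : Prop :=
  forall C : F3_coalgebra R, exists! f : triHom C D, coalgebra_morphism f.

Section Plane.
Variable R : realType.
Implicit Types p q r : 'rV[R]_2.

Definition plane_pt (x y : R) : 'rV[R]_2 :=
  \row_(i < 2) if i == 0 :> nat then x else y.

Definition vertex (m : M3) : 'rV[R]_2 :=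
  match m with
  | Ma => plane_pt 2^-1 (Num.sqrt 3 / 2)
  | Mb => plane_pt 0 0
  | Mc => plane_pt 1 0
  end.

Definition gasket_map (m : M3) p : 'rV[R]_2 := 2^-1 *: (p + vertex m).

(* The library norm on ['rV[R]_2] is the sup norm, hence this definition; both
   induce the same topology, so [compact] below has its usual meaning. *)
Definition euclid_dist p q : R :=
  Num.sqrt (\sum_(i < 2) (p 0 i - q 0 i) ^+ 2).

Definition is_gasket (S : set 'rV[R]_2) : Prop :=
  [/\ S !=set0, compact S &
      S = gasket_map Ma @` S `|` gasket_map Mb @` S `|` gasket_map Mc @` S].

(* Rescaled coordinates in which the vertices are (1/2, 1/2), (0, 0), (1, 0). *)
Definition cx p : R := p 0 0.
Definition cy p : R := p 0 1 / Num.sqrt 3.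

Lemma sqrt3_gt0 : 0 < Num.sqrt 3 :> R.
Proof. by rewrite sqrtr_gt0. Qed.

Lemma euclid_distE p q :
  euclid_dist p q = Num.sqrt ((cx p - cx q) ^+ 2 + 3 * (cy p - cy q) ^+ 2).
Proof.
rewrite /euclid_dist !big_ord_recl big_ord0 addr0 /cx /cy.
have -> : lift ord0 ord0 = 1 :> 'I_2 by apply/val_inj.
congr (Num.sqrt (_ + _)).
by rewrite -mulrBl expr_div_n sqr_sqrtr // mulrC divfK.
Qed.

Lemma coord_eq p q : cx p = cx q -> cy p = cy q -> p = q.
Proof.
rewrite /cx /cy => h1 h2; apply/rowP => i.
have {}h2 : p 0 1 = q 0 1.
  by apply: (mulIf (invr_neq0 (lt0r_neq0 sqrt3_gt0))).
case: i => [[|[|//]] hi].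
  have -> : Ordinal hi = 0 by exact/val_inj.
  exact: h1.
have -> : Ordinal hi = 1 by exact/val_inj.
exact: h2.
Qed.

Lemma euclid_dist_ge0 p q : 0 <= euclid_dist p q.
Proof. exact: sqrtr_ge0. Qed.

Lemma euclid_distsq p q :
  euclid_dist p q ^+ 2 = (cx p - cx q) ^+ 2 + 3 * (cy p - cy q) ^+ 2.
Proof.
rewrite euclid_distE sqr_sqrtr //.
by rewrite addr_ge0 ?sqr_ge0 // mulr_ge0 ?sqr_ge0.
Qed.

Lemma euclid_distxx p : euclid_dist p p = 0.
Proof. by rewrite euclid_distE !subrr expr0n /= mulr0 addr0 sqrtr0. Qed.

Lemma euclid_dist0 p q : euclid_dist p q = 0 -> p = q.
Proof.
move=> h; have := euclid_distsq p q; rewrite h expr0n /= => e.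
have h1 := sqr_ge0 (cx p - cx q); have h2 := sqr_ge0 (cy p - cy q).
have /eqP : (cx p - cx q) ^+ 2 = 0 by lra.
have /eqP : (cy p - cy q) ^+ 2 = 0 by lra.
rewrite !sqrf_eq0 !subr_eq0 => /eqP e1 /eqP e2; exact: coord_eq.
Qed.

Lemma euclid_dist_sym p q : euclid_dist p q = euclid_dist q p.
Proof. by rewrite !euclid_distE; congr Num.sqrt; ring. Qed.

Lemma euclid_dist_triangle q p r :
  euclid_dist p r <= euclid_dist p q + euclid_dist q r.
Proof.
have a0 := euclid_dist_ge0 p q; have b0 := euclid_dist_ge0 q r.
have A := euclid_distsq p q; have B := euclid_distsq q r.
rewrite -(@ler_pXn2r _ 2) // ?nnegrE ?euclid_dist_ge0 ?addr_ge0 //.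
rewrite euclid_distsq [leRHS]sqrrD A B.
set a := euclid_dist p q in a0 A *; set b := euclid_dist q r in b0 B *.
set x := cx p - cx q in A *; set y := cy p - cy q in A *.
set z := cx q - cx r in B *; set w := cy q - cy r in B *.
have -> : cx p - cx r = x + z by rewrite /x /z; ring.
have -> : cy p - cy r = y + w by rewrite /y /w; ring.
suff : x * z + 3 * (y * w) <= a * b by rewrite -mulr_natl; nra.
have [h|h] := leP (x * z + 3 * (y * w)) 0; first exact: le_trans h (mulr_ge0 a0 b0).
rewrite -(@ler_pXn2r _ 2) // ?nnegrE ?mulr_ge0 ?(ltW h) //.
rewrite exprMn A B; have := sqr_ge0 (x * w - y * z); nra.
Qed.

Lemma euclid_dist_le p q (c : R) : 0 <= c ->
  (cx p - cx q) ^+ 2 + 3 * (cy p - cy q) ^+ 2 <= c ^+ 2 -> euclid_dist p q <= c.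
Proof.
by move=> c0; rewrite -euclid_distsq ler_pXn2r ?nnegrE ?euclid_dist_ge0.
Qed.

Lemma cxE x y : cx (plane_pt x y) = x.
Proof. by rewrite /cx mxE. Qed.
Lemma cyE x y : cy (plane_pt x y) = y / Num.sqrt 3.
Proof. by rewrite /cy mxE. Qed.

Definition vx (m : M3) : R :=
  match m with Ma => 2^-1 | Mb => 0 | Mc => 1 end.
Definition vy (m : M3) : R :=
  match m with Ma => 2^-1 | _ => 0 end.
Lemma cx_vertex m : cx (vertex m) = vx m.
Proof. by case: m; rewrite /= cxE. Qed.
Lemma cy_vertex m : cy (vertex m) = vy m.
Proof.
case: m; rewrite /= cyE ?mul0r //.
by rewrite mulrAC divff ?mul1r // lt0r_neq0 // sqrt3_gt0.
Qed.
Lemma cx_map m p : cx (gasket_map m p) = (cx p + vx m) / 2.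
Proof. by rewrite -cx_vertex /gasket_map /cx !mxE mulrC. Qed.
Lemma cy_map m p : cy (gasket_map m p) = (cy p + vy m) / 2.
Proof. by rewrite -cy_vertex /gasket_map /cy !mxE; ring. Qed.

Lemma euclid_dist_map m p q :
  euclid_dist (gasket_map m p) (gasket_map m q) = 2^-1 * euclid_dist p q.
Proof.
apply/eqP; rewrite -(@eqrXn2 _ 2) ?mulr_ge0 ?invr_ge0 ?euclid_dist_ge0 //.
by apply/eqP; rewrite exprMn !euclid_distsq !cx_map !cy_map; field.
Qed.

Lemma gasket_map_vertex m : gasket_map m (vertex m) = vertex m.
Proof.
by apply: coord_eq; rewrite ?cx_map ?cy_map ?cx_vertex ?cy_vertex; field.
Qed.

Lemma gasket_map_glue m n :
  gasket_map m (vertex n) = gasket_map n (vertex m).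
Proof.
by apply: coord_eq; rewrite ?cx_map ?cy_map ?cx_vertex ?cy_vertex; field.
Qed.

(* Barycentric coordinates with respect to the vertices. *)
Definition bary (m : M3) p : R :=
  match m with
  | Ma => 2 * cy p
  | Mb => 1 - cx p - cy p
  | Mc => cx p - cy p
  end.

Lemma bary_map m n p :
  bary n (gasket_map m p) = (bary n p + (m == n)%:R) / 2.
Proof. by case: m n => [] [] /=; rewrite ?cx_map ?cy_map /=; field. Qed.

Lemma bary_lip m p q : `|bary m p - bary m q| <= 2 * euclid_dist p q.
Proof.
have e0 := euclid_dist_ge0 p q; have e := euclid_distsq p q.
rewrite -(@ler_pXn2r _ 2) // ?nnegrE ?mulr_ge0 // real_normK ?num_real //.
rewrite exprMn e.
have := sqr_ge0 (cx p - cx q); have := sqr_ge0 (cy p - cy q).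
have := sqr_ge0 (cx p - cx q + (cy p - cy q)).
have := sqr_ge0 (cx p - cx q - (cy p - cy q)).
by case: m => /=; nra.
Qed.

Definition in_triangle p := forall m, 0 <= bary m p.

Lemma triangle_vertex m p : in_triangle p ->
  euclid_dist p (vertex m) <= 1 - bary m p.
Proof.
move=> h; have := h Ma; have := h Mb; have := h Mc => /= h1 h2 h3.
by case: m; apply: euclid_dist_le; rewrite ?cx_vertex ?cy_vertex /=; nra.
Qed.

Lemma triangle_diam p q : in_triangle p -> in_triangle q ->
  euclid_dist p q <= 1.
Proof.
wlog le : p q / cy p <= cy q.
  move=> H hp hq; have [h|h] := leP (cy p) (cy q); first exact: H.
  by rewrite euclid_dist_sym; apply: H => //; exact: ltW.
move=> hp hq; apply: euclid_dist_le => //.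
have := hp Ma; have := hp Mb; have := hp Mc => /= h1 h2 h3.
have := hq Ma; have := hq Mb; have := hq Mc => /= k1 k2 k3.
have : (cx p - cx q) ^+ 2 <= (1 - (cy q - cy p)) ^+ 2.
  have d0 : 0 <= 1 - (cy q - cy p) by lra.
  rewrite -[leLHS]real_normK ?num_real // ler_pXn2r ?nnegrE //.
  by rewrite ler_norml; lra.
have : 0 <= (cy q - cy p) * (1 - 2 * (cy q - cy p)) by apply: mulr_ge0; lra.
nra.
Qed.

Lemma cont_mul (f g : 'rV[R]_2 -> R) : continuous f -> continuous g ->
  continuous (fun p => f p * g p).
Proof. by move=> cf cg p; apply: continuousM; [exact: cf | exact: cg]. Qed.

Lemma cont_sub (f g : 'rV[R]_2 -> R) : continuous f -> continuous g ->
  continuous (fun p => f p - g p).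
Proof. by move=> cf cg p; apply: continuousB; [exact: cf | exact: cg]. Qed.

Lemma cont_add (f g : 'rV[R]_2 -> R) : continuous f -> continuous g ->
  continuous (fun p => f p + g p).
Proof. by move=> cf cg p; apply: continuousD; [exact: cf | exact: cg]. Qed.

Lemma cont_cst (c : R) : continuous (fun _ : 'rV[R]_2 => c).
Proof. by move=> p; exact: cst_continuous. Qed.

Lemma cx_continuous : continuous cx.
Proof. exact: (@coord_continuous R _ _ 0 0). Qed.

Lemma cy_continuous : continuous cy.
Proof.
apply: cont_mul; last exact: cont_cst.
exact: (@coord_continuous R _ _ 0 1).
Qed.

Lemma bary_continuous m : continuous (bary m).
Proof.
have c0 := cx_continuous; have c1 := cy_continuous.
have cst := cont_cst.
case: m; [exact: cont_mul | apply: cont_sub => // | exact: cont_sub].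
exact: cont_sub.
Qed.

Lemma euclid_dist_continuous q : continuous (euclid_dist^~ q).
Proof.
have c0 := @cont_sub cx (fun=> cx q) (@cx_continuous) (@cont_cst (cx q)).
have c1 := @cont_sub cy (fun=> cy q) (@cy_continuous) (@cont_cst (cy q)).
rewrite (_ : euclid_dist^~ q = Num.sqrt \o (fun p =>
  (cx p - cx q) ^+ 2 + 3 * (cy p - cy q) ^+ 2)); last first.
  by apply/funext => p; rewrite /= euclid_distE.
move=> p; apply: continuous_comp; last exact: sqrt_continuous.
apply: (@cont_add (fun p => (cx p - cx q) ^+ 2)).
  exact: (cont_mul c0 c0).
exact: (cont_mul (@cont_cst 3) (cont_mul c1 c1)).
Qed.

End Plane.

Section Gasket.
Variables (R : realType) (S : set 'rV[R]_2).

Definition gasket_pt : Type := {p : 'rV[R]_2 | p \in S}.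
HB.instance Definition _ := Choice.on gasket_pt.

Definition gasket_dist (p q : gasket_pt) : R := euclid_dist (val p) (val q).

Lemma gasket_distxx p : gasket_dist p p = 0.
Proof. exact: euclid_distxx. Qed.
Lemma gasket_dist0 p q : gasket_dist p q = 0 -> p = q.
Proof. by move=> /euclid_dist0 /val_inj. Qed.
Lemma gasket_dist_sym p q : gasket_dist p q = gasket_dist q p.
Proof. exact: euclid_dist_sym. Qed.
Lemma gasket_dist_triangle q p r :
  gasket_dist p r <= gasket_dist p q + gasket_dist q r.
Proof. exact: euclid_dist_triangle. Qed.
HB.instance Definition _ := isMetric.Build R gasket_pt
  gasket_distxx gasket_dist0 gasket_dist_sym gasket_dist_triangle.

Hypothesis SG : is_gasket S.

Lemma gasket_stable m p : S p -> S (gasket_map m p).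
Proof.
case: SG => _ _ E Sp; rewrite E.
by case: m; [left; left | left; right | right]; exists p.
Qed.

Lemma gasket_inv p : S p -> exists m, exists2 q, S q & p = gasket_map m q.
Proof.
case: SG => _ _ E; rewrite {1}E => -[[|]|] [q Sq <-].
- by exists Ma, q.
- by exists Mb, q.
- by exists Mc, q.
Qed.

Lemma gasket_min (f : 'rV[R]_2 -> R) : continuous f ->
  exists2 c, S c & forall p, S p -> f c <= f p.
Proof.
case: SG => S0 cS _ cf.
have [c Sc h] := EVT_min_rV S0 cS (continuous_subspaceT cf).
exists c; first exact: set_mem.
by move=> p Sp; apply: h; exact: mem_set.
Qed.

Lemma gasket_vertex m : S (vertex R m).
Proof.
have [c Sc h] := gasket_min (@euclid_dist_continuous R (vertex R m)).
have := h _ (gasket_stable m Sc).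
rewrite -[in leRHS](gasket_map_vertex R m) euclid_dist_map => e.
have e0 := euclid_dist_ge0 c (vertex R m).
suff /euclid_dist0 <- : euclid_dist c (vertex R m) = 0 by [].
by lra.
Qed.

Lemma gasket_triangle p : S p -> in_triangle p.
Proof.
move=> Sp m.
have [c Sc h] := gasket_min (@bary_continuous R m).
have [n [q Sq e]] := gasket_inv Sc.
have := h _ Sq; have := h _ Sp; rewrite {2}e {1}e bary_map.
have : (0 : R) <= (n == m)%:R by rewrite ler0n.
have : bary m c = bary m (gasket_map n q) by rewrite -e.
by rewrite bary_map; lra.
Qed.

Definition gasket_vx (m : M3) : gasket_pt :=
  exist _ (vertex R m) (mem_set (gasket_vertex m)).

Lemma gasket_le1 (p q : gasket_pt) : mdist p q <= 1.
Proof.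
by apply: triangle_diam; apply: gasket_triangle; apply: set_mem; apply: valP.
Qed.

Lemma vertex_dist m n : m != n -> mdist (gasket_vx m) (gasket_vx n) = 1.
Proof.
move=> mn; apply/eqP; rewrite eq_le gasket_le1 /=.
have e : (1 : R) ^+ 2 = euclid_dist (vertex R m) (vertex R n) ^+ 2.
  rewrite euclid_distsq !cx_vertex !cy_vertex.
  by move: m n mn => [] [] //= _; field.
by rewrite -(@ler_pXn2r _ 2) // ?nnegrE ?euclid_dist_ge0 // e.
Qed.

Definition gasket : triMetric R :=
  @TriMetric R gasket_pt (gasket_vx Ma) (gasket_vx Mb) (gasket_vx Mc)
    gasket_le1 (@vertex_dist Ma Mb isT) (@vertex_dist Ma Mc isT)
    (@vertex_dist Mb Mc isT).

Lemma gasket_corner m : corner gasket m = gasket_vx m.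
Proof. by case: m. Qed.

Definition gasket_sub (m : M3) (p : gasket) : gasket :=
  exist _ (gasket_map m (val p)) (mem_set (gasket_stable m (set_mem (valP p)))).

Lemma gasket_sub_dist m n (x y : gasket) :
  pre_dist (m, x) (n, y) <= 4 * mdist (gasket_sub m x) (gasket_sub n y).
Proof.
have [<-|mn] := eqVneq m n.
  rewrite pre_dist_eq [X in _ <= _ * X]euclid_dist_map.
  by change (2^-1 * mdist x y <= 4 * (2^-1 * mdist x y));
    have := mdist_ge0 x y; lra.
rewrite pre_dist_ne //.
have hx := gasket_triangle (set_mem (valP x)).
have hy := gasket_triangle (set_mem (valP y)).
have h1 : mdist x (corner gasket n) <= 1 - bary n (val x).
  by rewrite gasket_corner; exact: triangle_vertex.
have h2 : mdist (corner gasket m) y <= 1 - bary m (val y).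
  by rewrite metric_sym gasket_corner; exact: triangle_vertex.
set D := mdist (gasket_sub m x) _.
have k1 : `|bary n (gasket_map m (val x)) - bary n (gasket_map n (val y))|
    <= 2 * D by exact: bary_lip.
have k2 : `|bary m (gasket_map m (val x)) - bary m (gasket_map n (val y))|
    <= 2 * D by exact: bary_lip.
move: k1 k2; rewrite !ler_norml !bary_map !eqxx (negbTE mn) eq_sym (negbTE mn).
move=> /andP[k1 _] /andP[_ k2].
have := hy n; have := hx m.
move: h1 h2 k1 k2; rewrite mulr0n mulr1n.
set a := mdist x _; set b := mdist _ y.
set c := _ + 1 + _ => h1 h2 k1 k2 h3 h4.
have : Num.min (a + b) c <= a + b by rewrite ge_min lexx.
by lra.
Qed.

Definition gasket_glue (u : tensor gasket) : gasket :=
  gasket_sub (repr u).1 (repr u).2.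

Lemma gasket_sub_glue p q : glue p q ->
  gasket_sub p.1 p.2 = gasket_sub q.1 q.2.
Proof. by case=> /=; apply/val_inj; exact: gasket_map_glue. Qed.

Lemma gasket_glue_tens m x : gasket_glue (tens m x) = gasket_sub m x.
Proof.
rewrite /gasket_glue; have := repr_dist (m, x); rewrite -/(tens m x) => h.
have /asboolP : tensor_eq (repr (tens m x)) (m, x) by rewrite pre_dist0 h.
move: (repr _) => p {h} h; change (gasket_sub m x) with
  (gasket_sub (m, x).1 (m, x).2).
elim: h => {p m x} [p q|//|p q _ ->|p q r _ -> _ ->] //.
exact: gasket_sub_glue.
Qed.

Lemma gasket_glue_dist (u v : F3 gasket) :
  mdist u v <= 4 * mdist (gasket_glue u) (gasket_glue v).
Proof.
elim/tens_ind: u => m x; elim/tens_ind: v => n y.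
rewrite [leLHS]tens_dist !gasket_glue_tens; exact: gasket_sub_dist.
Qed.

Lemma gasket_glue_surj p : exists u, gasket_glue u = p.
Proof.
have [m [q Sq e]] := gasket_inv (set_mem (valP p)).
exists (tens m (exist _ q (mem_set Sq) : gasket)); rewrite gasket_glue_tens.
exact/val_inj.
Qed.

(* The inverse of [m (x) p |-> gasket_map m p]: see [gasket_splitK] and
   [gasket_glueK]. *)
Definition gasket_split (p : gasket) : tensor gasket :=
  projT1 (cid (gasket_glue_surj p)).

Lemma gasket_splitK : cancel gasket_split gasket_glue.
Proof. by move=> p; exact: projT2 (cid (gasket_glue_surj p)). Qed.

Lemma gasket_glueK : cancel gasket_glue gasket_split.
Proof.
move=> u; have := gasket_glue_dist (gasket_split (gasket_glue u)) u.
rewrite gasket_splitK mdistxx mulr0 => h.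
by apply: (@mdist_positivity R (F3 gasket)); apply/eqP; rewrite eq_le h mdist_ge0.
Qed.

Lemma gasket_split_lipschitz : exists K : R, forall p q : gasket,
  mdist (gasket_split p : F3 gasket) (gasket_split q) <= K * mdist p q.
Proof.
exists 4 => p q.
by rewrite (le_trans (gasket_glue_dist _ _)) // !gasket_splitK.
Qed.

Lemma gasket_split_vertex m : gasket_split (gasket_vx m) =
  tens m (gasket_vx m : gasket).
Proof.
apply: (can_inj gasket_glueK); rewrite gasket_splitK gasket_glue_tens.
by apply/val_inj; rewrite /= gasket_map_vertex.
Qed.

Definition gasket_sigma : triHom gasket (F3 gasket) :=
  @TriHom _ gasket (F3 gasket) gasket_split gasket_split_lipschitz
    (gasket_split_vertex Ma) (gasket_split_vertex Mb) (gasket_split_vertex Mc).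

Definition gasket_coalgebra : F3_coalgebra R := F3Coalgebra gasket_sigma.

End Gasket.

Section GasketExistence.
Variable R : realType.

Lemma gasket_sub_unique (S S' : set 'rV[R]_2) :
  is_gasket S -> is_gasket S' -> S `<=` S'.
Proof.
move=> hS hS' p0 Sp0.
have near n : forall p, S p ->
    exists2 q, S' q & euclid_dist q p <= (2^-1 : R) ^+ n.
  elim: n => [|n IH] p Sp.
    case: (hS') => -[q S'q] _ _; exists q => //; rewrite expr0.
    by apply: triangle_diam; [exact: gasket_triangle hS' _ _ | exact: gasket_triangle hS _ _].
  have [m [p' Sp' ->]] := gasket_inv hS Sp.
  have [q S'q le] := IH _ Sp'.
  exists (gasket_map m q); first exact: gasket_stable.
  by rewrite euclid_dist_map exprS ler_wpM2l // invr_ge0.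
have [c S'c h] := gasket_min hS' (@euclid_dist_continuous R p0).
have [e0|e0] := eqVneq (euclid_dist c p0) 0; first by rewrite -(euclid_dist0 e0).
have dpos : 0 < euclid_dist c p0 by rewrite lt_neqAle eq_sym e0 euclid_dist_ge0.
set d := euclid_dist c p0 in dpos h.
have d1 : 0 <= d^-1 by rewrite invr_ge0 ltW.
have [q S'q le] := near (Num.bound d^-1) p0 Sp0.
have := le_trans (h _ S'q) le; rewrite -/d exprVn.
rewrite -[d <= _]lef_pV2 ?posrE ?invr_gt0 ?exprn_gt0 // invrK.
have lt1 := archi_boundP d1.
have : (Num.bound d^-1)%:R <= (2 : R) ^+ Num.bound d^-1.
  by rewrite -natrX ler_nat ltnW // ltn_expl.
by move=> lt2 lt3; have := le_lt_trans (le_trans lt2 lt3) lt1; rewrite ltxx.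
Qed.

Lemma gasket_unique (S S' : set 'rV[R]_2) :
  is_gasket S -> is_gasket S' -> S = S'.
Proof.
by move=> hS hS'; apply/seteqP; split; apply: gasket_sub_unique.
Qed.

Definition gasket_unmap (m : M3) (p : 'rV[R]_2) : 'rV[R]_2 :=
  2 *: p - vertex R m.

Lemma gasket_mapK m : cancel (@gasket_map R m) (gasket_unmap m).
Proof.
by move=> p; rewrite /gasket_unmap /gasket_map scalerA divff // scale1r addrK.
Qed.

Lemma gasket_unmapK m : cancel (gasket_unmap m) (@gasket_map R m).
Proof.
by move=> p; rewrite /gasket_unmap /gasket_map subrK scalerA mulVf // scale1r.
Qed.

Lemma gasket_unmap_continuous m : continuous (gasket_unmap m).
Proof.
move=> p; apply: continuousB; last exact: cst_continuous.
by apply: continuousZl_tmp; exact: id.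
Qed.

(* The n-th union of images of the full triangle; the gasket is the
   intersection over n. *)
Fixpoint gasket_approx (n : nat) : set 'rV[R]_2 :=
  if n is n'.+1 then [set p | exists m, gasket_approx n' (gasket_unmap m p)]
  else @in_triangle R.

Lemma gasket_approxS n p : gasket_approx n.+1 p -> gasket_approx n p.
Proof.
elim: n p => [|n IH] p; last by move=> [m h]; exists m; exact: IH.
move=> [m h] k; have := h k; rewrite -{2}(gasket_unmapK m p) bary_map.
by have : (0 : R) <= (m == k)%:R; [rewrite ler0n | lra].
Qed.

Lemma gasket_approx_le n k p : (n <= k)%N -> gasket_approx k p -> gasket_approx n p.
Proof.
elim: k => [|k IH]; first by rewrite leqn0 => /eqP ->.
rewrite leq_eqVlt => /predU1P[-> //|/IH h] /gasket_approxS; exact: h.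
Qed.

Lemma gasket_approx_closed n : closed (gasket_approx n).
Proof.
elim: n => [|n IH].
  rewrite (_ : gasket_approx 0 = \bigcap_(m in [set: M3])
      (@bary R m @^-1` [set x | 0 <= x])); last first.
    by apply/seteqP; split=> p h; [move=> m _; exact: h | move=> m; exact: h].
  apply: closed_bigI => m _; apply: closed_comp; last exact: closed_ge.
  by move=> x _; exact: bary_continuous.
have cl m : closed (gasket_unmap m @^-1` gasket_approx n).
  by apply: closed_comp => // x _; exact: gasket_unmap_continuous.
rewrite (_ : gasket_approx n.+1 = gasket_unmap Ma @^-1` gasket_approx n `|`
  gasket_unmap Mb @^-1` gasket_approx n `|` gasket_unmap Mc @^-1` gasket_approx n).
  by do 2?[apply: closedU]; exact: cl.
apply/seteqP; split=> p /=; last by case=> [[|]|] h; eexists; exact: h.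
by case=> -[] h; [left; left | left; right | right].
Qed.

Lemma gasket_exists : exists S : set 'rV[R]_2, is_gasket S.
Proof.
exists (\bigcap_n gasket_approx n); split.
- exists (vertex R Ma) => n _; elim: n => [|n IH].
    by case; rewrite /bary ?cx_vertex ?cy_vertex /=; lra.
  by exists Ma; rewrite -{1}(gasket_map_vertex R Ma) gasket_mapK.
- apply: (@subclosed_compact _ _
    [set v : 'rV[R]_2 | forall i, `[-2, 2]%classic (v ord0 i)]).
  + by apply: closed_bigI => n _; exact: gasket_approx_closed.
  + by apply: (@rV_compact R _ (fun=> `[-2, 2]%classic)) => i; exact: segment_compact.
  + move=> p /(_ 0%N I) h.
    have := h Ma; have := h Mb; have := h Mc => /= h1 h2 h3 i.
    have s0 := sqrt3_gt0 R.
    have s2 : Num.sqrt 3 <= 2 :> R.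
      by rewrite -(@ler_pXn2r _ 2) // ?nnegrE ?(ltW s0) // sqr_sqrtr //; lra.
    have e0 : p 0 0 = cx p by [].
    have e1 : p 0 1 = cy p * Num.sqrt 3 by rewrite /cy divfK // lt0r_neq0.
    case: i => [[|[|//]] hi]; rewrite /= in_itv /=.
      have -> : Ordinal hi = 0 by exact/val_inj.
      by rewrite -[ord0]/(0 : 'I_1) e0; lra.
    have -> : Ordinal hi = 1 by exact/val_inj.
    by rewrite -[ord0]/(0 : 'I_1) e1; nra.
- apply/seteqP; split=> p h.
  + have [m hm] : exists m, forall n, gasket_approx n (gasket_unmap m p).
      apply: contrapT => /forallNP no.
      have {}no m : exists n, ~ gasket_approx n (gasket_unmap m p).
        exact/existsNP/no.
      have [na ha] := no Ma; have [nb hb] := no Mb; have [nc hc] := no Mc.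
      have [m] := h (maxn na (maxn nb nc)).+1 I.
      case: m => /gasket_approx_le le.
      - by apply: ha; apply: le; rewrite leq_maxl.
      - by apply: hb; apply: le; rewrite !leq_max leqnn orbT.
      - by apply: hc; apply: le; rewrite !leq_max leqnn !orbT.
    have img : (gasket_map m @` \bigcap_n gasket_approx n) p.
      by exists (gasket_unmap m p); [move=> n _; exact: hm | exact: gasket_unmapK].
    by case: m img {hm} => img; [left; left | left; right | right].
  + have {h} [m [q hq <-]] :
        exists m, (gasket_map m @` \bigcap_n gasket_approx n) p.
      by case: h => [[|]|] h; eexists; exact: h.
    move=> n _; apply: gasket_approxS; exists m.
    by rewrite gasket_mapK; exact: hq.
Qed.

End GasketExistence.

(* Main.v *)
Require Import Defs.
From HB Require Import structures.
From mathcomp Require Import all_boot all_order all_algebra.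
From mathcomp Require Import lra.
From mathcomp Require Import all_classical all_reals all_analysis.

(** The structure maps of co-algebras may expand distances by any constant
    factor, whereas a morphism [f] into the gasket is forced, by
    [f x = sigma_m (f x')] whenever [e x = m (x) x'], to contract exactly by
    [1/2] at each step of the recursion.  So a co-algebra whose points collapse
    faster than [2^-n] along the recursion defeats every Lipschitz constant.

    Such a co-algebra is the needle: besides [L] and [R] it has points
    [x_0 = T, x_1, x_2, ...] with [d(x_n, L) = 4^-n], and its structure map
    sends [x_(n+1)] to [b (x) x_n].  This is Lipschitz
    ([needle_step_lipschitz]): inside the copy [b] the map multiplies distances
    by [1/2 * 4 = 2], and the remaining points are isolated at distance [1].
    A morphism to the gasket satisfies [d(f x_n, f L) = 2^-n]
    ([needle_image_dist]), hence a Lipschitz constant [K] of [f] would give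
    [2^n <= K] for all [n].  Thus no morphism from the needle to the gasket
    exists at all. *)

Set Implicit Arguments.
Unset Strict Implicit.
Unset Printing Implicit Defensive.

Import Order.TTheory GRing.Theory Num.Theory.

Local Open Scope ring_scope.

Inductive needle_pt := NeedleL | NeedleR | NeedlePt of nat.

Definition needle_code (u : needle_pt) : option (option nat) :=
  match u with
  | NeedleL => None | NeedleR => Some None | NeedlePt n => Some (Some n)
  end.
Definition needle_decode (c : option (option nat)) : needle_pt :=
  match c with
  | None => NeedleL | Some None => NeedleR | Some (Some n) => NeedlePt n
  end.
Lemma needle_codeK : cancel needle_code needle_decode.
Proof. by case. Qed.
HB.instance Definition _ := Choice.copy needle_pt (can_type needle_codeK).

Section Needle.
Variable R : realType.

(** The alias carries [R], so that the metric, and with it the topology, is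
    determined by the type. *)
Definition needle_sort (_ : realType) : Type := needle_pt.
HB.instance Definition _ := Choice.copy (needle_sort R) needle_pt.
Implicit Types u v w : needle_sort R.

(** The distance to [NeedleL]. *)
Definition needle_weight u : R :=
  match u with NeedleL => 0 | NeedleR => 1 | NeedlePt n => 4^-1 ^+ n end.

(** Two distinct points are joined through [NeedleL], at the cost of the larger
    weight; this is an ultrametric. *)
Definition needle_dist u v : R :=
  if u == v then 0 else Num.max (needle_weight u) (needle_weight v).

Lemma needle_weight_ge0 u : 0 <= needle_weight u.
Proof. by case: u => [||n] //=; rewrite exprn_ge0 ?invr_ge0. Qed.

Lemma needle_weight_le1 u : needle_weight u <= 1.
Proof. by case: u => [||n] //=; rewrite exprn_ile1 //; lra. Qed.

Lemma needle_weight_eq0 u : needle_weight u = 0 -> u = NeedleL.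
Proof.
case: u => [||n] //= /eqP; first by rewrite oner_eq0.
by rewrite expf_eq0 invr_eq0 pnatr_eq0 andbF.
Qed.

Lemma needle_distxx u : needle_dist u u = 0.
Proof. by rewrite /needle_dist eqxx. Qed.

Lemma needle_dist0 u v : needle_dist u v = 0 -> u = v.
Proof.
rewrite /needle_dist; case: eqP => // _ h.
have weight0 w : needle_weight w <= 0 -> w = NeedleL.
  move=> hw; apply: needle_weight_eq0; apply/eqP.
  by rewrite eq_le hw needle_weight_ge0.
rewrite (weight0 u); last by rewrite -h le_max lexx.
by rewrite (weight0 v); last by rewrite -h le_max lexx orbT.
Qed.

Lemma needle_dist_sym u v : needle_dist u v = needle_dist v u.
Proof. by rewrite /needle_dist eq_sym maxC. Qed.

Lemma needle_dist_ge0 u v : 0 <= needle_dist u v.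
Proof.
by rewrite /needle_dist; case: eqP => // _; rewrite le_max needle_weight_ge0.
Qed.

Lemma needle_dist_triangle v u w :
  needle_dist u w <= needle_dist u v + needle_dist v w.
Proof.
have [<-|uv] := eqVneq u v; first by rewrite needle_distxx add0r.
have [<-|vw] := eqVneq v w; first by rewrite needle_distxx addr0.
have [<-|uw] := eqVneq u w.
  by rewrite needle_distxx addr_ge0 // needle_dist_ge0.
rewrite /needle_dist (negbTE uv) (negbTE vw) (negbTE uw) ge_max.
have := needle_weight_ge0 u; have := needle_weight_ge0 w.
have hu : needle_weight u <= Num.max (needle_weight u) (needle_weight v).
  by rewrite le_max lexx.
have hw : needle_weight w <= Num.max (needle_weight v) (needle_weight w).
  by rewrite le_max lexx orbT.
by move=> *; apply/andP; split; lra.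
Qed.

HB.instance Definition _ := isMetric.Build R (needle_sort R)
  needle_distxx needle_dist0 needle_dist_sym needle_dist_triangle.

Lemma needle_mdistE u v : mdist u v = needle_dist u v.
Proof. by []. Qed.

Lemma needle_le1 u v : mdist u v <= 1.
Proof.
rewrite needle_mdistE /needle_dist; case: eqP => // _.
by rewrite ge_max !needle_weight_le1.
Qed.

Let needleT : needle_sort R := NeedlePt 0.
Let needleL : needle_sort R := NeedleL.
Let needleR : needle_sort R := NeedleR.

Lemma needle_TL : mdist needleT needleL = 1.
Proof. by rewrite needle_mdistE /needle_dist /= max_l. Qed.

Lemma needle_TR : mdist needleT needleR = 1.
Proof. by rewrite needle_mdistE /needle_dist /= max_l. Qed.

Lemma needle_LR : mdist needleL needleR = 1.
Proof. by rewrite needle_mdistE /needle_dist /= max_r. Qed.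

Definition needle : triMetric R :=
  TriMetric needle_le1 needle_TL needle_TR needle_LR.

Definition needle_step (u : needle) : F3 needle :=
  match (u : needle_pt) with
  | NeedleL => tens Mb (NeedleL : needle)
  | NeedleR => tens Mc (NeedleR : needle)
  | NeedlePt 0 => tens Ma (NeedlePt 0 : needle)
  | NeedlePt n.+1 => tens Mb (NeedlePt n : needle)
  end.

(** Only [T] and [R] leave the copy [b], and they have weight [1]; elsewhere one
    step of the recursion multiplies the distance to [L] by [4]. *)
Lemma needle_step_cases (u : needle) :
  needle_weight u = 1 \/
  exists2 u' : needle, needle_step u = tens Mb u' &
    needle_weight u' = 4 * needle_weight u.
Proof.
case: u => [||[|n]].
- by right; exists (NeedleL : needle); rewrite //= mulr0.
- by left.
- by left.
- right; exists (NeedlePt n : needle) => //=.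
  by rewrite exprS mulrA divff ?mul1r ?pnatr_eq0.
Qed.

Lemma needle_step_lipschitz : exists K : R, forall u v : needle,
  mdist (needle_step u) (needle_step v) <= K * mdist u v.
Proof.
exists 2 => u v; have [<-|uv] := eqVneq u v; first by rewrite !mdistxx mulr0.
have -> : mdist u v = Num.max (needle_weight u) (needle_weight v).
  by rewrite needle_mdistE /needle_dist (negbTE uv).
set M := Num.max _ _.
have hu : needle_weight u <= M by rewrite le_max lexx.
have hv : needle_weight v <= M by rewrite le_max lexx orbT.
have le1 := tm_le1 (needle_step u) (needle_step v).
have [u1|[u' eu wu]] := needle_step_cases u; first by lra.
have [v1|[v' ev wv]] := needle_step_cases v; first by lra.
rewrite eu ev [leLHS]tens_dist pre_dist_eq needle_mdistE.
have : needle_dist u' v' <= 4 * M.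
  rewrite /needle_dist; case: eqP => [_|_]; last by rewrite ge_max wu wv; lra.
  by have := needle_weight_ge0 u; lra.
by lra.
Qed.

Definition needle_hom : triHom needle (F3 needle) :=
  @TriHom _ needle (F3 needle) needle_step needle_step_lipschitz
    erefl erefl erefl.

Definition needle_coalgebra : F3_coalgebra R := F3Coalgebra needle_hom.

End Needle.

(** The recursion satisfied by any morphism into the gasket: the structure map
    of the gasket is inverse to gluing. *)
Lemma gasket_morphismE (R : realType) (S : set 'rV[R]_2) (SG : is_gasket S)
    (C : F3_coalgebra R) (f : triHom C (gasket_coalgebra SG)) (x y : C) m :
  coalgebra_morphism f -> co_map C x = tens m y ->
  f x = @gasket_sub _ _ SG m (f y).
Proof.
move=> /(_ x) fx e; rewrite -[f x]gasket_splitK.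
have -> : gasket_split (f x) = tens m (f y).
  by rewrite -tensor_map_tens -e; exact: fx.
by rewrite gasket_glue_tens.
Qed.

(** Both [x_(n+1)] and [L] lie in the copy [b], over [x_n] and [L], so each
    step of the recursion halves the distance of the images. *)
Lemma needle_image_dist (R : realType) (S : set 'rV[R]_2) (SG : is_gasket S)
    (f : triHom (needle_coalgebra R) (gasket_coalgebra SG)) n :
  coalgebra_morphism f ->
  mdist (f (NeedlePt n : needle R)) (f (NeedleL : needle R)) = 2^-1 ^+ n.
Proof.
move=> hf; elim: n => [|n IH].
  by rewrite (tri_T f) (tri_L f) tm_TL expr0.
have step (u v : needle_coalgebra R) :
    co_map (needle_coalgebra R) u = tens Mb v ->
    f u = @gasket_sub _ _ SG Mb (f v) by exact: gasket_morphismE.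
rewrite (step _ (NeedlePt n : needle R)) //.
rewrite [f (NeedleL : needle R) in LHS](step _ (NeedleL : needle R)) //.
by rewrite [LHS]euclid_dist_map exprS -IH.
Qed.

Theorem mainTheorem7 (R : realType) (S : set 'rV[R]_2) (SG : is_gasket S) :
  ~ final_coalgebra (gasket_coalgebra SG).
Proof.
move=> /(_ (needle_coalgebra R)) [f [hf _]].
have [K hK] := tri_lipschitz f.
have bound n : 2 ^+ n <= K.
  have := hK (NeedlePt n : needle R) (NeedleL : needle R).
  rewrite needle_image_dist // [X in _ * X]needle_mdistE /needle_dist /=.
  rewrite max_l ?exprn_ge0 ?invr_ge0 // => h.
  have p4 : 0 < 4 ^+ n :> R by rewrite exprn_gt0.
  move: h; rewrite exprVn [4^-1 ^+ n]exprVn ler_pdivlMr //.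
  rewrite (_ : 4 = 2 * 2 :> R); last by rewrite -natrM.
  by rewrite exprMn mulKf // expf_neq0 // pnatr_eq0.
have K0 : 0 <= K by have := bound 0%N; rewrite expr0; lra.
have := le_lt_trans (bound (Num.bound K)) (archi_boundP K0).
by rewrite -natrX ltr_nat ltnNge ltnW // ltn_expl.
Qed.
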